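(* Let $N$ be a nonlinear connection on $E^*=J^{1*}(\mathcal T,M)$ and $D$ an $N$-linear connection with adapted coefficients $D\Gamma(N)$. The polymomentum deflection d-tensor fields $\Delta^{(a)}_{(i)b}=\mathbb C^{(a)}_{(i)/b}$, $\Delta^{(a)}_{(i)j}=\mathbb C^{(a)}_{(i)|j}$, $\vartheta^{(a)(j)}_{(i)(b)}=\mathbb C^{(a)}_{(i)}|^{(j)}_{(b)}$, where $\mathbb C^{(a)}_{(i)}=p^a_i$, have the expressions $$\Delta^{(a)}_{(i)b}=-\underset{1}{N}{}^{(a)}_{(i)b}-A^{(a)(k)}_{(i)(c)b}p^c_k,\qquad \Delta^{(a)}_{(i)j}=-\underset{2}{N}{}^{(a)}_{(i)j}-H^{(a)(k)}_{(i)(c)j}p^c_k,$$ $$\vartheta^{(a)(j)}_{(i)(b)}=\delta^a_b\delta^j_i-C^{(a)(k)(j)}_{(i)(c)(b)}p^c_k.$$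
   Context: All objects are smooth. $\mathcal T,M$ are manifolds of dimensions $m,n$ with local coordinates $(t^a)$, $(x^i)$. Indices $a,\dots,h$ run over $\{1,\dots,m\}$, indices $i,j,k,l,p,q,r,s$ over $\{1,\dots,n\}$; Einstein summation is used. $E^*=J^{1*}(\mathcal T,M)$ is the dual of the $1$-jet bundle: a vector bundle $\pi^*:E^*\to\mathcal T\times M$ with fibre $\mathbb R^{mn}$ and induced coordinates $(t^a,x^i,p^a_i)$ changing by $\tilde t^a=\tilde t^a(t)$, $\tilde x^i=\tilde x^i(x)$, $\tilde p^a_i=\frac{\partial x^j}{\partial\tilde x^i}\frac{\partial\tilde t^a}{\partial t^b}p^b_j$. A nonlinear connection $N$ is a distribution on $E^*$ complementary to the vertical distribution $\mathcal W=\ker\pi^*{}_*$; locally it is spanned by $\frac{\delta}{\delta t^a}=\frac{\partial}{\partial t^a}-\underset{1}{N}{}^{(b)}_{(j)a}\frac{\partial}{\partial p^b_j}$ and $\frac{\delta}{\delta x^i}=\frac{\partial}{\partial x^i}-\underset{2}{N}{}^{(b)}_{(j)i}\frac{\partial}{\partial p^b_j}$, which together with $\frac{\partial}{\partial p^a_i}$ form the adapted basis. $\mathcal H_{\mathcal T}$, $\mathcal H_M$ are the distributions spanned by $\delta/\delta t^a$ and by $\delta/\delta x^i$. An $N$-linear connection $D$ is a linear connection on $E^*$ preserving by parallelism $\mathcal H_{\mathcal T},\mathcal H_M,\mathcal W$ (i.e. $D_X$ maps sections of each to sections of the same). Its nine families of adapted coefficients include those defined by $$D_{\frac{\delta}{\delta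 t^c}}\frac{\partial}{\partial p^b_j}=-A^{(a)(j)}_{(i)(b)c}\frac{\partial}{\partial p^a_i},\quad D_{\frac{\delta}{\delta x^k}}\frac{\partial}{\partial p^b_j}=-H^{(a)(j)}_{(i)(b)k}\frac{\partial}{\partial p^a_i},\quad D_{\frac{\partial}{\partial p^c_k}}\frac{\partial}{\partial p^b_j}=-C^{(a)(j)(k)}_{(i)(b)(c)}\frac{\partial}{\partial p^a_i}.$$ For a vertical d-vector field $Y=Y^{(a)}_{(i)}\frac{\partial}{\partial p^a_i}$, the local covariant derivatives $Y^{(a)}_{(i)/c}$, $Y^{(a)}_{(i)|k}$, $Y^{(a)}_{(i)}|^{(k)}_{(c)}$ ($\mathcal T$-horizontal, $M$-horizontal, vertical) are the components along $\frac{\partial}{\partial p^a_i}$ of $D_{\delta/\delta t^c}Y$, $D_{\delta/\delta x^k}Y$, $D_{\partial/\partial p^c_k}Y$. The Liouville–Hamilton d-tensor field of polymomenta is $\mathbb C^*=\mathbb C^{(a)}_{(i)}\frac{\partial}{\partial p^a_i}$ with $\mathbb C^{(a)}_{(i)}=p^a_i$. *)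

(* Defs.v *)
From mathcomp Require Import all_boot all_order all_algebra.
From mathcomp Require Import all_classical all_reals all_analysis.

Set Implicit Arguments.
Unset Strict Implicit.
Unset Printing Implicit Defensive.

Import Order.TTheory GRing.Theory Num.Theory.
Import numFieldNormedType.Exports.

Local Open Scope classical_set_scope.
Local Open Scope ring_scope.

Section Smooth.
Context {R : realType} {V W : normedModType R}.

Definition iter_derive (vs : seq V) (f : V -> W) : V -> W :=
  foldr (fun v g z => 'D_v g z) f vs.

(* C^infinity on the open set A; every model space used below is
   finite-dimensional. *)
Definition smooth_on (A : set V) (f : V -> W) : Prop :=
  forall (vs : seq V) (z : V), A z -> differentiable (iter_derive vs f) z.

End Smooth.

(* A set with V-valued charts, without any axiom. The topology is the one
   given by the charts (mopen), so no topology is put on apoint. *)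
Record atlas (R : realType) (V : normedModType R) := Atlas {
  apoint :> Type;
  chart : Type;
  dom : chart -> set apoint;
  crd : chart -> apoint -> V
}.
Arguments dom {R V a}.
Arguments crd {R V a}.

Section Manifold.
Context {R : realType} {V : normedModType R}.
Implicit Type E : atlas V.

(* The local expression of f in the chart c, that is f \o (crd c)^-1 on the
   image of the chart, and 0 elsewhere. *)
Definition in_chart {E} {W : normedModType R} (c : chart E) (f : E -> W)
    (z : V) : W :=
  match pselect (exists e, dom c e /\ crd c e = z) with
  | left ex => f (projT1 (cid ex))
  | right _ => 0
  end.

Definition transition {E} (c d : chart E) : V -> V := in_chart c (crd d).

Definition mopen {E} (U : set E) : Prop :=
  forall c : chart E, open (crd c @` (U `&` dom c)).

Record smooth_manifold E : Prop := SmoothManifold {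
  chart_cover : forall e : E, exists c : chart E, dom c e;
  chart_inj : forall c : chart E, {in dom c &, injective (crd c)};
  chart_open : forall c d : chart E, open (crd c @` (dom c `&` dom d));
  chart_smooth : forall c d : chart E,
    smooth_on (crd c @` (dom c `&` dom d)) (transition c d);
  manifold_hausdorff : forall e e' : E, e <> e' ->
    exists U U' : set E,
      [/\ mopen U, mopen U', U e, U' e' & U `&` U' = set0];
  manifold_second_countable : exists S : set (chart E),
    countable S /\ forall e : E, exists2 c, S c & dom c e
}.

Definition smooth_fun {E} (U : set E) (f : E -> R) : Prop :=
  forall c : chart E,
    smooth_on (crd c @` (U `&` dom c)) (in_chart c (f : E -> R^o)).

(* A tangent vector at e is a family of components v c : V, one for each
   chart c around e, related by the derivatives of the transition maps. The
   values of v at the charts which are not around e are irrelevant. *)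
Definition cvec E : Type := chart E -> V.

Definition tangent {E} (e : E) (v : cvec E) : Prop :=
  forall c d : chart E, dom c e -> dom d e ->
    v d = 'd (transition c d) (crd c e) (v c).

Definition teq {E} (e : E) (v w : cvec E) : Prop :=
  forall c : chart E, dom c e -> v c = w c.

Definition field E : Type := E -> cvec E.

Definition feq {E} (U : set E) (X Y : field E) : Prop :=
  forall e, U e -> teq e (X e) (Y e).

Definition vfield {E} (U : set E) (X : field E) : Prop :=
  (forall e, U e -> tangent e (X e)) /\
  (forall c : chart E,
     smooth_on (crd c @` (U `&` dom c)) (in_chart c (fun e => X e c))).

(* The vector field on dom c whose components in the chart c are w. *)
Definition chart_field {E} (c : chart E) (w : E -> V) : field E :=
  fun e d => 'd (transition c d) (crd c e) (w e).

Definition tdistribution E : Type := E -> set (cvec E).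

Definition smooth_distribution {E} (k : nat) (H : tdistribution E) : Prop :=
  forall e : E, exists (U : set E) (Z : 'I_k -> field E),
    [/\ mopen U, U e, forall i, vfield U (Z i) &
      forall e', U e' ->
        (forall u : 'I_k -> R,
           teq e' (fun c => \sum_i u i *: Z i e' c) (fun=> 0) ->
           forall i, u i = 0) /\
        (forall v, tangent e' v ->
           (H e' v <-> exists u : 'I_k -> R,
              teq e' v (fun c => \sum_i u i *: Z i e' c)))].

Definition complementary {E} (H K : tdistribution E) : Prop :=
  forall e : E,
    (forall v, tangent e v -> exists h w,
       [/\ tangent e h, H e h, tangent e w, K e w &
           teq e v (fun c => h c + w c)]) /\
    (forall v, tangent e v -> H e v -> K e v -> teq e v (fun=> 0)).

Definition section_of {E} (H : tdistribution E) (U : set E) (Y : field E) :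
    Prop :=
  vfield U Y /\ forall e, U e -> H e (Y e).

(* A linear connection as an operator on local vector fields: the data
   D_U X Y, for X, Y vector fields on an open set U, compatible with
   restrictions, amount to a single D such that D X Y only depends near e
   on X and Y near e (lc_local). Only the values of D X Y on open sets
   where X and Y are vector fields matter. *)
Record linear_connection {E} (D : field E -> field E -> field E) : Prop :=
LinearConnection {
  lc_vfield : forall U X Y, mopen U -> vfield U X -> vfield U Y ->
    vfield U (D X Y);
  lc_local : forall U X X' Y Y', mopen U ->
    vfield U X -> vfield U X' -> vfield U Y -> vfield U Y' ->
    feq U X X' -> feq U Y Y' -> feq U (D X Y) (D X' Y');
  lc_addl : forall U X X' Y, mopen U ->
    vfield U X -> vfield U X' -> vfield U Y ->
    feq U (D (fun e c => X e c + X' e c) Y)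
          (fun e c => D X Y e c + D X' Y e c);
  lc_scalel : forall U (f : E -> R) X Y, mopen U ->
    smooth_fun U f -> vfield U X -> vfield U Y ->
    feq U (D (fun e c => f e *: X e c) Y)
          (fun e c => f e *: D X Y e c);
  lc_addr : forall U X Y Y', mopen U ->
    vfield U X -> vfield U Y -> vfield U Y' ->
    feq U (D X (fun e c => Y e c + Y' e c))
          (fun e c => D X Y e c + D X Y' e c);
  lc_leibniz : forall U (f : E -> R) X Y, mopen U ->
    smooth_fun U f -> vfield U X -> vfield U Y ->
    feq U (D X (fun e c => f e *: Y e c))
          (fun e c =>
             ('d (in_chart c (f : E -> R^o)) (crd c e) (X e c) : R) *: Y e c
             + f e *: D X Y e c)
}.

Definition preserves {E} (D : field E -> field E -> field E)
    (H : tdistribution E) : Prop :=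
  forall U X Y, mopen U -> vfield U X -> section_of H U Y ->
    section_of H U (D X Y).

End Manifold.

Section DualJet.
Context {R : realType} {m n : nat}.
Variables (T : atlas 'rV[R]_m) (M : atlas 'rV[R]_n).

(* d f^j / d z^i *)
Definition partial {k : nat} (f : 'rV[R]_k -> 'rV[R]_k) (i j : 'I_k)
    (z : 'rV[R]_k) : R :=
  ('D_(delta_mx 0 i) f z) 0 j.

(* A point over (t, x) is an element of T_t T (x) T_x^* M, the dual of the
   fibre T_t^* T (x) T_x M of the 1-jet bundle; it is given by its components
   p^a_i = jp al be a i in all pairs of charts al around t, be around x. The
   conventional zero value for the other pairs ensures that distinct elements
   of dual_jet_pt are distinct points of J^{1*}. *)
Record dual_jet_pt : Type := DualJetPt {
  jt : T;
  jx : M;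
  jp : chart T -> chart M -> 'M[R]_(m, n);
  jp_change : forall (al al' : chart T) (be be' : chart M),
    dom al jt -> dom al' jt -> dom be jx -> dom be' jx ->
    forall (a : 'I_m) (i : 'I_n),
      jp al' be' a i = \sum_j \sum_b
        partial (transition be' be) i j (crd be' jx) *
        partial (transition al al') b a (crd al jt) * jp al be b j;
  jp_out : forall al be, ~ (dom al jt /\ dom be jx) -> jp al be = 0
}.

Definition jspace : normedModType R :=
  ('rV[R]_m * 'rV[R]_n * 'M[R]_(m, n))%type.

Definition dual_jet : atlas jspace :=
  @Atlas R jspace dual_jet_pt (chart T * chart M)%type
    (fun q e => dom q.1 (jt e) /\ dom q.2 (jx e))
    (fun q e => (crd q.1 (jt e), crd q.2 (jx e), jp e q.1 q.2)).

End DualJet.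

Section Connections.
Context {R : realType} {m n : nat} {T : atlas 'rV[R]_m} {M : atlas 'rV[R]_n}.
Local Notation E := (dual_jet T M).
Local Notation V := (@jspace R m n).

Definition pcoord (q : chart E) (e : E) (a : 'I_m) (i : 'I_n) : R :=
  (crd q e).2 a i.

(* Components of d/dt^a, d/dx^i, d/dp^a_i in the chart they come from. *)
Definition dt (a : 'I_m) : V := (delta_mx 0 a, 0, 0).
Definition dx (i : 'I_n) : V := (0, delta_mx 0 i, 0).
Definition dp (a : 'I_m) (i : 'I_n) : V := (0, 0, delta_mx a i).

(* W = ker pi^*_* : the projection pi^* onto T x M is (t, x, p) |-> (t, x)
   in coordinates. *)
Definition vertical : tdistribution E :=
  fun e v => forall q : chart E, dom q e -> (v q).1 = 0.

Definition nonlinear_connection (N : tdistribution E) : Prop :=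
  smooth_distribution (m + n) N /\ complementary N vertical.

(* N1 q e b j a is the coefficient N_1^{(b)}_{(j)a}, and N2 q e b j i the
   coefficient N_2^{(b)}_{(j)i}, in the chart q at e. *)
Definition Ncoef1 : Type := chart E -> E -> 'I_m -> 'I_n -> 'I_m -> R.
Definition Ncoef2 : Type := chart E -> E -> 'I_m -> 'I_n -> 'I_n -> R.

(* Components of delta/delta t^a and delta/delta x^i in the chart q. *)
Definition delta_t (N1 : Ncoef1) (q : chart E) (a : 'I_m) (e : E) : V :=
  dt a - \sum_b \sum_j N1 q e b j a *: dp b j.
Definition delta_x (N2 : Ncoef2) (q : chart E) (i : 'I_n) (e : E) : V :=
  dx i - \sum_b \sum_j N2 q e b j i *: dp b j.

(* N is spanned by the delta/delta t^a and delta/delta x^i in every induced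
   chart. *)
Definition nonlinear_coefficients (N : tdistribution E)
    (N1 : Ncoef1) (N2 : Ncoef2) : Prop :=
  forall (q : chart E) (e : E), dom q e -> forall v, tangent e v ->
    (N e v <-> exists (u : 'I_m -> R) (w : 'I_n -> R),
       v q = \sum_a u a *: delta_t N1 q a e + \sum_i w i *: delta_x N2 q i e).

Definition H_T (N1 : Ncoef1) : tdistribution E :=
  fun e v => forall q : chart E, dom q e ->
    exists u : 'I_m -> R, v q = \sum_a u a *: delta_t N1 q a e.
Definition H_M (N2 : Ncoef2) : tdistribution E :=
  fun e v => forall q : chart E, dom q e ->
    exists u : 'I_n -> R, v q = \sum_i u i *: delta_x N2 q i e.

Definition N_linear_connection (N1 : Ncoef1) (N2 : Ncoef2)
    (D : field E -> field E -> field E) : Prop :=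
  [/\ linear_connection D, preserves D (H_T N1), preserves D (H_M N2) &
      preserves D vertical].

Definition fdelta_t (N1 : Ncoef1) q a : field E := chart_field q (delta_t N1 q a).
Definition fdelta_x (N2 : Ncoef2) q i : field E := chart_field q (delta_x N2 q i).
Definition fdp (q : chart E) a i : field E := chart_field q (fun=> dp a i).

(* The vertical adapted coefficients of D:
   A q e a i b j c = A^{(a)(j)}_{(i)(b)c},
   H q e a i b j k = H^{(a)(j)}_{(i)(b)k},
   C q e a i b j c k = C^{(a)(j)(k)}_{(i)(b)(c)}. *)
Definition Acoef : Type :=
  chart E -> E -> 'I_m -> 'I_n -> 'I_m -> 'I_n -> 'I_m -> R.
Definition Hcoef : Type :=
  chart E -> E -> 'I_m -> 'I_n -> 'I_m -> 'I_n -> 'I_n -> R.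
Definition Ccoef : Type :=
  chart E -> E -> 'I_m -> 'I_n -> 'I_m -> 'I_n -> 'I_m -> 'I_n -> R.

Record vertical_coefficients (N1 : Ncoef1) (N2 : Ncoef2)
    (D : field E -> field E -> field E)
    (A : Acoef) (H : Hcoef) (C : Ccoef) : Prop := VerticalCoefficients {
  coefA : forall q b j c, feq (dom q) (D (fdelta_t N1 q c) (fdp q b j))
    (fun e d => - \sum_a \sum_i A q e a i b j c *: fdp q a i e d);
  coefH : forall q b j k, feq (dom q) (D (fdelta_x N2 q k) (fdp q b j))
    (fun e d => - \sum_a \sum_i H q e a i b j k *: fdp q a i e d);
  coefC : forall q b j c k, feq (dom q) (D (fdp q c k) (fdp q b j))
    (fun e d => - \sum_a \sum_i C q e a i b j c k *: fdp q a i e d)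
}.

(* The component of v along dp a i in the adapted basis delta_t N1 q,
   delta_x N2 q, dp at e; see adapted_decomposition. *)
Definition vcomp (N1 : Ncoef1) (N2 : Ncoef2) (q : chart E) (e : E) (v : V)
    (a : 'I_m) (i : 'I_n) : R :=
  v.2 a i + \sum_b v.1.1 0 b * N1 q e a i b + \sum_j v.1.2 0 j * N2 q e a i j.

Lemma adapted_decomposition (N1 : Ncoef1) (N2 : Ncoef2) q e (v : V) :
  v = \sum_a v.1.1 0 a *: delta_t N1 q a e
    + \sum_i v.1.2 0 i *: delta_x N2 q i e
    + \sum_a \sum_i vcomp N1 N2 q e v a i *: dp a i.
Proof.
have eqV (u w : V) : u.1.1 = w.1.1 -> u.1.2 = w.1.2 -> u.2 = w.2 -> u = w.
  by case: u => [[? ?] ?]; case: w => [[? ?] ?] /= -> -> ->.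
have s11 I (r : seq I) (F : I -> V) :
    (\sum_(k <- r) F k).1.1 = \sum_(k <- r) (F k).1.1.
  by rewrite (big_morph (fun x : V => x.1.1) (id1 := 0) (op1 := +%R)).
have s12 I (r : seq I) (F : I -> V) :
    (\sum_(k <- r) F k).1.2 = \sum_(k <- r) (F k).1.2.
  by rewrite (big_morph (fun x : V => x.1.2) (id1 := 0) (op1 := +%R)).
have s2 I (r : seq I) (F : I -> V) :
    (\sum_(k <- r) F k).2 = \sum_(k <- r) (F k).2.
  by rewrite (big_morph (fun x : V => x.2) (id1 := 0) (op1 := +%R)).
have vert (F : 'I_m -> 'I_n -> R) :
    \sum_a \sum_i F a i *: dp a i = (0, 0, \matrix_(a, i) F a i).
  apply: eqV.
  - by rewrite s11 big1// => a _; rewrite s11 big1// => i _; rewrite /= scaler0.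
  - by rewrite s12 big1// => a _; rewrite s12 big1// => i _; rewrite /= scaler0.
  rewrite s2 [RHS]matrix_sum_delta; apply: eq_bigr => a _.
  by rewrite s2; apply: eq_bigr => i _; rewrite mxE.
case: v => [[t x] p]; apply: eqV.
- rewrite /= vert !s11 /= addr0 [X in _ + X]big1 ?addr0.
    rewrite [LHS]row_sum_delta; apply: eq_bigr => a _.
    by rewrite /delta_t vert /= subr0.
  by move=> i _; rewrite /delta_x vert /= subr0 scaler0.
- rewrite /= vert !s12 /= addr0 [X in X + _]big1 ?add0r.
    rewrite [LHS]row_sum_delta; apply: eq_bigr => i _.
    by rewrite /delta_x vert /= subr0.
  by move=> a _; rewrite /delta_t vert /= subr0 scaler0.
rewrite /= vert !s2 /=; apply/matrixP => a i.
rewrite !mxE !summxE /vcomp /=.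
have -> : \sum_b (t 0 b *: delta_t N1 q b e).2 a i =
          - \sum_b t 0 b * N1 q e a i b.
  rewrite -sumrN; apply: eq_bigr => b _.
  by rewrite /delta_t vert /= sub0r !mxE mulrN.
have -> : \sum_j (x 0 j *: delta_x N2 q j e).2 a i =
          - \sum_j x 0 j * N2 q e a i j.
  rewrite -sumrN; apply: eq_bigr => j _.
  by rewrite /delta_x vert /= sub0r !mxE mulrN.
by rewrite addrC addrA [p a i + _ + _]addrAC !addrK.
Qed.

(* The local covariant derivatives of Y in the chart q, with (a, i)
   components Y^{(a)}_{(i)/c}, Y^{(a)}_{(i)|k} and Y^{(a)}_{(i)}|^{(k)}_{(c)}. *)
Definition cov_t N1 N2 (D : field E -> field E -> field E) (Y : field E)
    q c e a i : R :=
  vcomp N1 N2 q e (D (fdelta_t N1 q c) Y e q) a i.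
Definition cov_x N1 N2 (D : field E -> field E -> field E) (Y : field E)
    q k e a i : R :=
  vcomp N1 N2 q e (D (fdelta_x N2 q k) Y e q) a i.
Definition cov_p N1 N2 (D : field E -> field E -> field E) (Y : field E)
    q c k e a i : R :=
  vcomp N1 N2 q e (D (fdp q c k) Y e q) a i.

(* The Liouville-Hamilton field p^a_i d/dp^a_i; it is a global vector field. *)
Definition liouville : field E :=
  fun e q => \sum_a \sum_i pcoord q e a i *: dp a i.

End Connections.

(* Main.v *)
From HB Require Import structures.
Require Import Defs.
From mathcomp Require Import all_boot all_order all_algebra.
From mathcomp Require Import all_classical all_reals all_analysis.
Import GRing.Theory numFieldNormedType.Exports.
Local Open Scope classical_set_scope.
Local Open Scope ring_scope.

Set Implicit Arguments.
Unset Strict Implicit.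
Unset Printing Implicit Defensive.

(** On the domain of an induced chart [q], the Liouville-Hamilton field is
    the finite sum of the [p^c_k d/dp^c_k], so additivity and the Leibniz rule
    give, for every vector field [X] on [dom q],

      [D_X C = sum X(p^c_k) d/dp^c_k + sum p^c_k D_X (d/dp^c_k)].

    The function [X(p^a_i)] is the [(a, i)] fibre component of [X], which is
    [- N_1] for [delta/delta t], [- N_2] for [delta/delta x] and a product of
    Kronecker symbols for [d/dp^b_j]; the coefficients of [D] give the second
    sum. Everything is vertical, so that the component along [d/dp^a_i] in
    the adapted basis is the naive one. This computation is [cov_liouville].

    The axioms of a linear connection say something only about smooth vector
    fields and functions, and the weight of the proof is to show that the
    fields above are smooth in all the charts of the dual jet bundle:

    - the maps that are smooth on an open set are closed under sums, products,
      inverses and composition (the latter because all model spaces have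
      finitely many coordinates), so that the inverse of a matrix with smooth
      entries has smooth entries;
    - the dual jet bundle is a smooth atlas ([jet_atlas]). A point of it can
      be prescribed by its base point and one matrix of components
      ([make_jet]), so a chart image is the product of the chart images of the
      base with the whole space of matrices, and the transition maps are
      linear in [p] with coefficients the products of first derivatives of
      the transition maps of the base;
    - in such an atlas, a field with smooth components in the chart [q] is
      smooth in all other charts ([vfield_chart_field]). This settles the
      [d/dp^a_i];
    - since the transition maps are linear along the fibres, their differential
      changes the components of a vertical vector as it changes the [p^a_i],
      so that the Liouville-Hamilton field obeys the tensor law and is the sum
      above in every chart ([liouville_chart]);
    - the distribution [N] has smooth local frames, and the matrix of such a
      frame in the [delta/delta t], [delta/delta x] consists of [t] and [x]
      components; inverting it expresses the adapted fields through a smooth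
      frame ([smooth_hframe]). *)

(** * Closure properties of smooth maps *)

Section Calculus.
Context {R : realType}.
Implicit Types V W X : normedModType R.

Lemma near_eq_differentiable V W (f g : V -> W) (z : V) :
  (\near z, f z = g z) -> differentiable f z -> differentiable g z.
Proof.
move=> fg /[dup] df /diff_locallyP[dc /eqaddoP fE].
have gE : g \o shift z = cst (g z) + 'd f z +o_ 0 id.
  apply/eqaddoP => _/posnumP[e].
  have : \forall h \near 0, f (h + z) = g (h + z).
    move: fg; rewrite (near_shift 0) /=.
    by apply: filterS => h /=; rewrite subr0.
  apply: filter_app2 (fE e%:num [gt0 of e%:num]).
  apply: filterE => h fgh fgE; move: fgh.
  by rewrite !fctE /cst /shift /= fgE (nbhs_singleton fg).
have dgE : 'd g z = 'd f z :> (V -> W) by exact: diff_unique.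
by apply/diff_locallyP; rewrite dgE.
Qed.

(** Smoothness to finite order, by recursion on the first derivative taken. The
    Leibniz and chain rules express a first derivative by maps of the same
    shape, so every closure property is an induction on [k]; [smooth_on],
    which takes all orders at once, offers no such induction. With [Ck 0]
    vacuous the base case is trivial, and [Ck k] is about the
    iterated derivatives of order less than [k]. *)
Fixpoint Ck V W k (A : set V) (f : V -> W) : Prop :=
  if k is k'.+1 then
    (forall z, A z -> differentiable f z) /\ forall v, Ck k' A ('D_v f)
  else True.

Lemma CkP V W (A : set V) (f : V -> W) : smooth_on A f <-> forall k, Ck k A f.
Proof.
split=> [sf k|cf vs z Az].
  elim: k f sf => [//|k IH] f sf; split=> [|v]; first exact: (sf [::]).
  apply: IH => vs z Az.
  by have := sf (rcons vs v) z Az; rewrite /iter_derive foldr_rcons.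
have : Ck (size vs).+1 A f by exact: cf.
elim/last_ind: vs f {cf} => [|vs v IH] f; first by case=> df _; exact: df.
by rewrite size_rcons => -[_ /(_ v) /IH]; rewrite /iter_derive foldr_rcons.
Qed.

Lemma Ck_le V W k (A : set V) (f : V -> W) : Ck k.+1 A f -> Ck k A f.
Proof.
elim: k f => [//|k IH] f [df Df]; split=> // v.
exact: IH (Df v).
Qed.

Section OnOpen.
Context {V : normedModType R} {A : set V}.
Hypothesis Aopen : open A.

Lemma near_on {W} (f g : V -> W) z : A z -> (forall z, A z -> f z = g z) ->
  \near z, f z = g z.
Proof. by move=> Az fg; apply: filterS (open_nbhs_nbhs (conj Aopen Az)). Qed.

Lemma Ck_eq W k (f g : V -> W) :
  (forall z, A z -> f z = g z) -> Ck k A f -> Ck k A g.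
Proof.
elim: k f g => [//|k IH] f g fg [df Df]; split=> [z Az|v].
- exact: near_eq_differentiable (near_on Az fg) (df z Az).
- apply: IH (Df v) => z Az; exact: near_eq_derive (near_on Az fg).
Qed.

Lemma Ck_cst W k (w : W) : Ck k A (cst w).
Proof.
elim: k w => [//|k IH] w; split=> // v.
rewrite (_ : 'D_v (cst w) = cst 0) //.
by apply/funext => z; rewrite derive_cst.
Qed.

Lemma Ck_lin W X k (L : {linear W -> X}) (f : V -> W) : continuous L ->
  Ck k A f -> Ck k A (L \o f).
Proof.
move=> Lc; elim: k f => [//|k IH] f [df Df].
have Ld z : differentiable L z by exact: linear_differentiable.
have LfD z : A z -> differentiable (L \o f) z.
  by move=> Az; apply: differentiable_comp => //; exact: df.
split=> // v; apply: Ck_eq (IH _ (Df v)) => z Az /=.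
have dfz := df z Az.
rewrite (deriveE _ (LfD z Az)) (deriveE _ dfz) (diff_comp dfz (Ld _)) /=.
by rewrite diff_lin.
Qed.

Lemma CkD W k (f g : V -> W) : Ck k A f -> Ck k A g -> Ck k A (f + g).
Proof.
elim: k f g => [//|k IH] f g [df Df] [dg Dg]; split=> [z Az|v].
- by apply: differentiableD; [exact: df|exact: dg].
apply: Ck_eq (IH _ _ (Df v) (Dg v)) => z Az.
by rewrite deriveD //; apply: diff_derivable; [exact: df|exact: dg].
Qed.

Lemma CkM k (f g : V -> R^o) : Ck k A f -> Ck k A g ->
  Ck k A (fun z => f z * g z : R^o).
Proof.
elim: k f g => [//|k IH] f g /[dup] /Ck_le fk [df Df] /[dup] /Ck_le gk [dg Dg].
split=> [z Az|v].
- by apply: differentiableM; [exact: df|exact: dg].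
apply: Ck_eq (CkD (IH _ _ fk (Dg v)) (IH _ _ gk (Df v))) => z Az.
by rewrite [RHS]deriveM //; apply: diff_derivable; [exact: df|exact: dg].
Qed.

Lemma CkV k (f : V -> R^o) : (forall z, A z -> f z != 0) -> Ck k A f ->
  Ck k A (fun z => (f z)^-1 : R^o).
Proof.
move=> f0; elim: k => [//|k IH] /[dup] /Ck_le /IH fk [df Df].
split=> [z Az|v]; first by apply: differentiableV; [exact: df|exact: f0].
apply: Ck_eq (CkM (CkM (CkM (Ck_cst k (-1 : R^o)) fk) fk) (Df v)) => z Az.
rewrite [RHS]deriveV; [|exact: f0|exact/diff_derivable/df].
by rewrite /cst mulN1r expr2 invfM !mulNr scaleNr.
Qed.

Lemma Ck_sum W (I : Type) (r : seq I) k (f : I -> V -> W) :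
  (forall i, Ck k A (f i)) -> Ck k A (fun z => \sum_(i <- r) f i z).
Proof.
move=> fk; rewrite (_ : (fun z => _) = \sum_(i <- r) f i).
  by elim/big_rec: _ => [|i g _]; [exact: Ck_cst|exact: CkD].
by apply/funext => z; rewrite fct_sumE.
Qed.

Lemma Ck_prod (I : Type) (r : seq I) k (f : I -> V -> R^o) :
  (forall i, Ck k A (f i)) -> Ck k A (fun z => \prod_(i <- r) f i z : R^o).
Proof.
move=> fk; elim: r => [|i r IH].
  apply: Ck_eq (Ck_cst k (1 : R^o)) => z _; by rewrite big_nil.
apply: Ck_eq (CkM (fk i) IH) => z _; by rewrite big_cons.
Qed.

Lemma Ck_scale W k (f : V -> R^o) (w : W) : Ck k A f ->
  Ck k A (fun z => f z *: w).
Proof.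
have wlin : linear ( *:%R^~ w : R^o -> W).
  by move=> a u v; rewrite scalerDl scalerA.
pose wM := GRing.isLinear.Build _ _ _ _ _ wlin.
pose wL : {linear R^o -> W} := HB.pack ( *:%R^~ w : R^o -> W) wM.
apply: (@Ck_lin _ _ _ wL); exact: scalel_continuous.
Qed.

End OnOpen.

End Calculus.

(** A finite system of continuous linear coordinates. It is carried as data
    because the chain rule for directional derivatives,
    [D_v (g o f) = sum_i (D_v f)_i (D_(e_i) g) o f], is closed under iteration
    only when the differential of [g] is expanded in a fixed basis. *)
Record coords (R : realType) (W : normedModType R) := Coords {
  cidx : finType;
  cvect : cidx -> W;
  cfun : cidx -> {linear W -> R^o};
  cfun_continuous : forall i, continuous (cfun i);
  coordsE : forall w, w = \sum_i cfun i w *: cvect i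
}.

Arguments cvect {R W}.
Arguments cfun {R W}.
Arguments cfun_continuous {R W}.
Arguments coordsE {R W}.

Section CalculusInCoordinates.
Context {R : realType}.
Implicit Types V W X : normedModType R.

Lemma Ck_coords V W (cW : coords W) k (A : set V) (f : V -> W) : open A ->
  (forall i, Ck k A (cfun cW i \o f)) -> Ck k A f.
Proof.
move=> Ao fk.
rewrite (_ : f = fun z => \sum_i (cfun cW i \o f) z *: cvect cW i).
  by apply: Ck_sum => // i; exact: Ck_scale.
by apply/funext => z; rewrite [LHS](coordsE cW).
Qed.

Lemma CkZ V W (cW : coords W) k (A : set V) (f : V -> R^o) (g : V -> W) :
  open A -> Ck k A f -> Ck k A g -> Ck k A (fun z => f z *: g z).
Proof.
move=> Ao fk gk; apply: (Ck_coords (cW := cW)) => // i.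
have gik : Ck k A (cfun cW i \o g).
  by apply: Ck_lin => //; exact: cfun_continuous.
apply: Ck_eq (CkM Ao fk gik) => // z _.
by rewrite /= linearZ.
Qed.

Lemma derive_comp V W X (cW : coords W) (g : W -> X) (f : V -> W) z v :
  differentiable f z -> differentiable g (f z) ->
  'D_v (g \o f) z = \sum_i cfun cW i ('D_v f z) *: 'D_(cvect cW i) g (f z).
Proof.
move=> df dg; rewrite (deriveE _ (differentiable_comp df dg)) (deriveE _ df).
rewrite (diff_comp df dg) /= [in LHS](coordsE cW ('d f z v)) linear_sum.
by apply: eq_bigr => i _; rewrite linearZ deriveE.
Qed.

Lemma Ck_comp V W X (cW : coords W) (cX : coords X) k (A : set V) (B : set W)
    (g : W -> X) (f : V -> W) : open A -> (forall z, A z -> B (f z)) ->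
  Ck k B g -> Ck k A f -> Ck k A (g \o f).
Proof.
move=> Ao fAB; elim: k g f fAB => [//|k IH] g f fAB [dg Dg].
move=> /[dup] /Ck_le fk [df Df].
split=> [z Az|v].
  by apply: differentiable_comp; [exact: df|exact/dg/fAB].
pose h z := \sum_i (cfun cW i \o 'D_v f) z *: ('D_(cvect cW i) g \o f) z.
apply: (Ck_eq Ao (f := h)) => // [z Az|].
  by rewrite (derive_comp cW) //; [exact: df|exact/dg/fAB].
apply: Ck_sum => // i; apply: (CkZ cX) => //.
  by apply: Ck_lin => //; [exact: cfun_continuous|exact: Df].
exact: (IH _ _ fAB (Dg _) fk).
Qed.

Section SmoothOn.
Context {V : normedModType R} {A : set V}.
Hypothesis Aopen : open A.

Lemma smooth_eq W (f g : V -> W) :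
  (forall z, A z -> f z = g z) -> smooth_on A f -> smooth_on A g.
Proof. by move=> fg /CkP sf; apply/CkP => k; apply: Ck_eq fg _. Qed.

Lemma smooth_cst W (w : W) : smooth_on A (cst w).
Proof. by apply/CkP => k; exact: Ck_cst. Qed.

Lemma smooth_lin W X (L : {linear W -> X}) (f : V -> W) : continuous L ->
  smooth_on A f -> smooth_on A (L \o f).
Proof. by move=> Lc /CkP sf; apply/CkP => k; exact: Ck_lin. Qed.

Lemma smoothD W (f g : V -> W) :
  smooth_on A f -> smooth_on A g -> smooth_on A (f + g).
Proof. by move=> /CkP sf /CkP sg; apply/CkP => k; exact: CkD. Qed.

Lemma smoothM (f g : V -> R^o) : smooth_on A f -> smooth_on A g ->
  smooth_on A (fun z => f z * g z : R^o).
Proof. by move=> /CkP sf /CkP sg; apply/CkP => k; exact: CkM. Qed.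

Lemma smoothV (f : V -> R^o) : (forall z, A z -> f z != 0) ->
  smooth_on A f -> smooth_on A (fun z => (f z)^-1 : R^o).
Proof. by move=> f0 /CkP sf; apply/CkP => k; exact: CkV. Qed.

Lemma smooth_sum W (I : Type) (r : seq I) (f : I -> V -> W) :
  (forall i, smooth_on A (f i)) ->
  smooth_on A (fun z => \sum_(i <- r) f i z).
Proof.
by move=> sf; apply/CkP => k; apply: Ck_sum => // i; exact: (CkP _ _).1.
Qed.

Lemma smooth_prod (I : Type) (r : seq I) (f : I -> V -> R^o) :
  (forall i, smooth_on A (f i)) ->
  smooth_on A (fun z => \prod_(i <- r) f i z : R^o).
Proof.
by move=> sf; apply/CkP => k; apply: Ck_prod => // i; exact: (CkP _ _).1.
Qed.

Lemma smooth_coords W (cW : coords W) (f : V -> W) :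
  (forall i, smooth_on A (cfun cW i \o f)) -> smooth_on A f.
Proof.
move=> sf; apply/CkP => k; apply: (Ck_coords (cW := cW)) => // i.
exact: (CkP _ _).1.
Qed.

Lemma smoothZ W (cW : coords W) (f : V -> R^o) (g : V -> W) :
  smooth_on A f -> smooth_on A g -> smooth_on A (fun z => f z *: g z).
Proof. by move=> /CkP sf /CkP sg; apply/CkP => k; exact: CkZ. Qed.

Lemma smooth_comp W X (cW : coords W) (cX : coords X) (B : set W)
    (g : W -> X) (f : V -> W) : (forall z, A z -> B (f z)) ->
  smooth_on B g -> smooth_on A f -> smooth_on A (g \o f).
Proof.
move=> fAB /CkP sg /CkP sf; apply/CkP => k.
exact: (Ck_comp cW cX Aopen fAB).
Qed.

Lemma smooth_derive W (f : V -> W) v : smooth_on A f -> smooth_on A ('D_v f).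
Proof.
move=> sf vs z Az; have := sf (rcons vs v) z Az.
by rewrite /iter_derive foldr_rcons.
Qed.

Lemma smooth_id : smooth_on A (id : V -> V).
Proof.
apply/CkP => -[|k] //; split=> [z _|v]; first exact: ex_diff.
apply: (Ck_eq Aopen (f := cst v)); last exact: Ck_cst.
by move=> z _; rewrite derive_id.
Qed.

Lemma smooth_det p (B : V -> 'M[R]_p) :
  (forall i j, smooth_on A (fun z => B z i j : R^o)) ->
  smooth_on A (fun z => \det (B z) : R^o).
Proof.
move=> sB; rewrite /determinant; apply: smooth_sum => s.
by apply: smoothM; [exact: smooth_cst|apply: smooth_prod => i].
Qed.

(** Cramer's rule makes the entries of the inverse rational functions of the
    entries of the matrix. *)
Lemma smooth_invmx p (B : V -> 'M[R]_p) : (forall z, A z -> B z \in unitmx) ->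
  (forall i j, smooth_on A (fun z => B z i j : R^o)) ->
  forall i j, smooth_on A (fun z => invmx (B z) i j : R^o).
Proof.
move=> uB sB i j.
apply: (@smooth_eq _ (fun z => (\det (B z))^-1 * cofactor (B z) j i : R^o)).
  by move=> z Az; rewrite /invmx uB // !mxE.
apply: smoothM.
  apply: smoothV; last exact: smooth_det.
  by move=> z /uB; rewrite unitmxE unitfE.
apply: smoothM; first exact: smooth_cst.
apply: smooth_det => i' j'.
apply: smooth_eq (sB (lift j i') (lift i j')) => z _; by rewrite !mxE.
Qed.

End SmoothOn.

End CalculusInCoordinates.

(** * Coordinates on matrices, products and scalars *)

Section MxCoords.
Context {R : realType}.
Variables p q : nat.

Definition mx_entry (k : 'I_p * 'I_q) (B : 'M[R]_(p, q)) : R^o := B k.1 k.2.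

Lemma mx_entry_linear k : linear (mx_entry k).
Proof. by move=> a B C; rewrite /mx_entry !mxE. Qed.

HB.instance Definition _ k :=
  GRing.isLinear.Build _ _ _ _ _ (mx_entry_linear k).

Lemma mx_entry_continuous k : continuous (mx_entry k).
Proof. exact: coord_continuous. Qed.

Lemma mx_entryE (B : 'M[R]_(p, q)) :
  B = \sum_k mx_entry k B *: delta_mx k.1 k.2.
Proof. by rewrite [LHS]matrix_sum_delta pair_bigA. Qed.

Definition mx_coords : coords 'M[R]_(p, q) :=
  Coords mx_entry_continuous mx_entryE.

End MxCoords.

Section PairCoords.
Context {R : realType} {V W : normedModType R} (cV : coords V) (cW : coords W).

Definition pair_fun (i : cidx cV + cidx cW) (z : V * W) : R^o :=
  match i with inl j => cfun cV j z.1 | inr j => cfun cW j z.2 end.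

Definition pair_vect (i : cidx cV + cidx cW) : V * W :=
  match i with inl j => (cvect cV j, 0) | inr j => (0, cvect cW j) end.

Lemma pair_fun_linear i : linear (pair_fun i).
Proof. by move=> a u v; case: i => i /=; rewrite linearP. Qed.

HB.instance Definition _ i :=
  GRing.isLinear.Build _ _ _ _ _ (pair_fun_linear i).

Lemma pair_fun_continuous i : continuous (pair_fun i).
Proof.
case: i => i z; apply: (@continuous_comp _ _ _ _ (cfun _ i)).
- exact: cvg_fst.
- exact: cfun_continuous.
- exact: cvg_snd.
- exact: cfun_continuous.
Qed.

Lemma pair_coordsE (z : V * W) : z = \sum_i pair_fun i z *: pair_vect i.
Proof.
have s1 (I : Type) (r : seq I) (F : I -> V * W) :
    (\sum_(i <- r) F i).1 = \sum_(i <- r) (F i).1.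
  by rewrite (big_morph (fun u : V * W => u.1) (id1 := 0) (op1 := +%R)).
have s2 (I : Type) (r : seq I) (F : I -> V * W) :
    (\sum_(i <- r) F i).2 = \sum_(i <- r) (F i).2.
  by rewrite (big_morph (fun u : V * W => u.2) (id1 := 0) (op1 := +%R)).
rewrite [RHS]surjective_pairing s1 s2 !big_sumType /= [LHS]surjective_pairing.
congr pair.
  rewrite [X in _ + X]big1 ?addr0; last by move=> i _; rewrite scaler0.
  exact: coordsE.
rewrite [X in X + _]big1 ?add0r; last by move=> i _; rewrite scaler0.
exact: coordsE.
Qed.

Definition pair_coords : coords (V * W)%type :=
  Coords pair_fun_continuous pair_coordsE.

End PairCoords.

Section ScalarCoords.
Context {R : realType}.

Lemma scalar_fun_continuous (i : 'I_1) :
  continuous (idfun : {linear R^o -> R^o}).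
Proof. by move=> x; exact: cvg_id. Qed.

Lemma scalar_coordsE (x : R^o) : x = \sum_(i < 1) idfun x *: (1 : R^o).
Proof. by rewrite big_ord1 [RHS]mulr1. Qed.

Definition scalar_coords : coords R^o :=
  @Coords R R^o 'I_1 (fun=> 1) (fun=> idfun)
    scalar_fun_continuous scalar_coordsE.

End ScalarCoords.

(** * Vector fields and connections in a smooth atlas *)

Section SmoothAtlas.
Context {R : realType} {V : normedModType R}.

(** The conditions of [smooth_manifold] that make vector fields pass from one
    chart to another; the dual jet bundle inherits them from its base. *)
Record smooth_atlas (E : atlas V) : Prop := SmoothAtlas {
  atlas_inj : forall c : chart E, {in dom c &, injective (crd c)};
  atlas_open : forall c d : chart E, open (crd c @` (dom c `&` dom d));
  atlas_smooth : forall c d : chart E,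
    smooth_on (crd c @` (dom c `&` dom d)) (transition c d)
}.

Arguments atlas_smooth {E} _ c d.

Lemma smooth_manifold_atlas (E : atlas V) :
  smooth_manifold E -> smooth_atlas E.
Proof. by case=> _ ? ? ? _ _. Qed.

Context {E : atlas V} (sE : smooth_atlas E).

Lemma in_chartE (W : normedModType R) (c : chart E) (f : E -> W) e :
  dom c e -> in_chart c f (crd c e) = f e.
Proof.
move=> ce; rewrite /in_chart; case: pselect => [ex|[]]; last by exists e.
case: cid => e' /= [ce' /(atlas_inj sE) -> //]; exact: mem_set.
Qed.

Lemma transitionE (c d : chart E) e :
  dom c e -> transition c d (crd c e) = crd d e.
Proof. exact: in_chartE. Qed.

Lemma mopen_dom (q : chart E) : mopen (dom q).
Proof. by move=> c; rewrite setIC; exact: atlas_open. Qed.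

Lemma open_dom_image (q : chart E) : open (crd q @` dom q).
Proof. by rewrite -[X in crd q @` X]setIid; exact: atlas_open. Qed.

Lemma transition_differentiable (c d : chart E) e : dom c e -> dom d e ->
  differentiable (transition c d) (crd c e).
Proof.
move=> ce de; have := @atlas_smooth _ sE c d [::] (crd c e); apply.
by exists e.
Qed.

(** Two maps on the model space that agree on the coordinates of the points of
    an open set agree near the coordinates of each of these points, so they
    have the same differential there. *)
Lemma diff_near_chart (W : normedModType R) (U : set E) (c : chart E) e
    (f g : V -> W) v : mopen U -> U e -> dom c e ->
  (forall e', U e' -> dom c e' -> f (crd c e') = g (crd c e')) ->
  differentiable f (crd c e) -> differentiable g (crd c e) ->
  'd f (crd c e) v = 'd g (crd c e) v.
Proof.
move=> Uo Ue ce fg df dg; rewrite -!deriveE //.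
have Aopen := Uo c; apply: near_eq_derive.
apply: (near_on Aopen); first by exists e.
by move=> _ [e' [Ue' ce'] <-]; exact: fg.
Qed.

Lemma diff_transition_comp (c d d' : chart E) e v :
  dom c e -> dom d e -> dom d' e ->
  'd (transition c d') (crd c e) v =
  'd (transition d d') (crd d e) ('d (transition c d) (crd c e) v).
Proof.
move=> ce de d'e.
have dcd := transition_differentiable ce de.
have ddd := transition_differentiable de d'e.
rewrite -(transitionE d ce) in ddd *.
transitivity ('d (transition d d' \o transition c d) (crd c e) v); last first.
  by rewrite (diff_comp dcd ddd).
refine (@diff_near_chart _ (dom d) c e _ _ v (mopen_dom d) de ce _ _ _).
- by move=> e' de' ce' /=; rewrite !transitionE.
- exact: transition_differentiable.
- exact: differentiable_comp.
Qed.

Lemma diff_transition_id (c : chart E) e v : dom c e ->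
  'd (transition c c) (crd c e) v = v.
Proof.
move=> ce; transitivity ('d (id : V -> V) (crd c e) v).
  refine (@diff_near_chart _ (dom c) c e _ _ v (mopen_dom c) ce ce _ _ _).
  - by move=> e' _ ce'; rewrite transitionE.
  - exact: transition_differentiable.
  - exact: ex_diff.
by rewrite diff_val.
Qed.

Lemma chart_field_self (q : chart E) (w : E -> V) e : dom q e ->
  chart_field q w e q = w e.
Proof. by move=> qe; rewrite /chart_field diff_transition_id. Qed.

Lemma tangent_chart_field (q : chart E) (w : E -> V) e : dom q e ->
  tangent e (chart_field q w e).
Proof. by move=> qe c d ce de; exact: diff_transition_comp. Qed.

Context (cV : coords V).

(** In the chart [c] the local expression is the one in [q] composed with a
    transition map. *)
Lemma smooth_change (W : normedModType R) (cW : coords W) (q c : chart E)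
    (f : E -> W) : smooth_on (crd q @` dom q) (in_chart q f) ->
  smooth_on (crd c @` (dom q `&` dom c)) (in_chart c f).
Proof.
move=> sf; have Ao := mopen_dom q c.
apply: (smooth_eq Ao (f := in_chart q f \o transition c q)).
  by move=> _ [e [qe ce] <-] /=; rewrite transitionE // !in_chartE.
apply: (smooth_comp Ao cV cW _ sf).
  by move=> _ [e [qe ce] <-]; rewrite transitionE //; exists e.
by rewrite setIC; exact: atlas_smooth.
Qed.

(** In another chart [c], the components are the images of [w] by the
    differential of the transition map at a moving point; expanding [w] in
    coordinates turns this into products of smooth functions with directional
    derivatives of a smooth map. *)
Lemma vfield_chart_field (q : chart E) (w : E -> V) :
  smooth_on (crd q @` dom q) (in_chart q w) ->
  vfield (dom q) (chart_field q w).
Proof.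
move=> sw; split=> [e|c]; first exact: tangent_chart_field.
have Ao := mopen_dom q c.
pose g z := \sum_i (cfun cV i \o in_chart c w) z *:
                   ('D_(cvect cV i) (transition q c) \o transition c q) z.
apply: (smooth_eq Ao (f := g)).
  move=> _ [e [qe ce] <-]; rewrite /g /= in_chartE // transitionE //.
  rewrite in_chartE // /chart_field [in RHS](coordsE cV (w e)) linear_sum.
  apply: eq_bigr => i _; rewrite linearZ deriveE //.
  exact: transition_differentiable.
apply: (smooth_sum Ao) => i; apply: (smoothZ Ao cV).
  apply: smooth_lin => //; first exact: cfun_continuous.
  exact: smooth_change.
apply: (smooth_comp Ao cV cV (B := crd q @` (dom q `&` dom c))).
- by move=> _ [e [qe ce] <-]; rewrite transitionE //; exists e.
- exact/smooth_derive/atlas_smooth.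
- by rewrite setIC; exact: atlas_smooth.
Qed.

Lemma vfield_eq (U : set E) (X Y : field E) :
  mopen U -> feq U X Y -> vfield U X -> vfield U Y.
Proof.
move=> Uo XY [tX sX]; split=> [e Ue c d ce de|c].
  by rewrite -!XY //; exact: tX.
apply: smooth_eq (sX c) => // _ [e [Ue ce] <-].
by rewrite !in_chartE //; exact: XY.
Qed.

Lemma vfield0 (U : set E) : mopen U -> vfield U (fun _ _ => 0).
Proof.
move=> Uo; split=> [e Ue c d _ _|c]; first by rewrite linear0.
refine (smooth_eq (Uo c) _ (smooth_cst (0 : V))) => _ [e [Ue ce] <-].
by rewrite in_chartE.
Qed.

Lemma vfieldD (U : set E) (X Y : field E) : mopen U ->
  vfield U X -> vfield U Y -> vfield U (fun e c => X e c + Y e c).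
Proof.
move=> Uo [tX sX] [tY sY]; split=> [e Ue c d ce de|c].
  by rewrite linearD (tX e Ue c d) // (tY e Ue c d).
refine (smooth_eq (Uo c) _ (smoothD (Uo c) (sX c) (sY c))) => _ [e [Ue ce] <-].
by rewrite !fctE !in_chartE.
Qed.

Lemma vfieldZ (U : set E) (f : E -> R) (X : field E) : mopen U ->
  smooth_fun U f -> vfield U X -> vfield U (fun e c => f e *: X e c).
Proof.
move=> Uo sf [tX sX]; split=> [e Ue c d ce de|c].
  by rewrite linearZ (tX e Ue c d).
refine (smooth_eq (Uo c) _ (smoothZ (Uo c) cV (sf c) (sX c))).
move=> _ [e [Ue ce] <-].
by rewrite !in_chartE.
Qed.

Lemma vfield_sum (U : set E) (I : Type) (r : seq I) (X : I -> field E) :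
  mopen U -> (forall i, vfield U (X i)) ->
  vfield U (fun e c => \sum_(i <- r) X i e c).
Proof.
move=> Uo vX; elim: r => [|i r IH].
  by apply: vfield_eq (vfield0 Uo) => // e _ c _; rewrite big_nil.
by apply: vfield_eq (vfieldD Uo (vX i) IH) => // e _ c _; rewrite big_cons.
Qed.

Section Connection.
Context {D : field E -> field E -> field E} (Dlin : linear_connection D).
Context {U : set E} (Uo : mopen U).

Lemma connection0 (X : field E) : vfield U X ->
  feq U (D X (fun _ _ => 0)) (fun _ _ => 0).
Proof.
move=> vX e Ue c ce; have v0 := vfield0 Uo.
have /(_ e Ue c ce) /= := lc_addr Dlin Uo vX v0 v0.
rewrite (_ : (fun _ _ => 0 + 0) = (fun _ _ => 0)); last first.
  by apply/funext => x; apply/funext => y; rewrite addr0.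
by move/eqP; rewrite -subr_eq subrr => /eqP.
Qed.

Lemma connection_sum (I : Type) (r : seq I) (X : field E) (Y : I -> field E) :
  vfield U X -> (forall i, vfield U (Y i)) ->
  feq U (D X (fun e c => \sum_(i <- r) Y i e c))
        (fun e c => \sum_(i <- r) D X (Y i) e c).
Proof.
move=> vX vY; elim: r => [|i r IH] e Ue c ce.
  rewrite big_nil -[RHS](connection0 vX Ue ce).
  by congr (D X _ e c); apply/funext => x; apply/funext => y; rewrite big_nil.
rewrite big_cons -(IH e Ue c ce).
rewrite -(lc_addr Dlin Uo vX (vY i) (vfield_sum r Uo vY) Ue ce).
by congr (D X _ e c); apply/funext => x; apply/funext => y; rewrite big_cons.
Qed.

End Connection.
End SmoothAtlas.

Arguments atlas_smooth {R V E} _ c d.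
Arguments open_dom_image {R V E} _ q.

(** * The dual jet bundle as a smooth atlas *)

Section Jacobian.
Context {R : realType} {k : nat} {E : atlas 'rV[R]_k} (sE : smooth_atlas E).

(** The matrix of the differential of a transition map, acting on row vectors
    from the right. *)
Definition jac (c d : chart E) (z : 'rV[R]_k) : 'M[R]_k :=
  \matrix_(i, j) partial (transition c d) i j z.

Lemma jacE (c d : chart E) e (v : 'rV[R]_k) : dom c e -> dom d e ->
  'd (transition c d) (crd c e) v = v *m jac c d (crd c e).
Proof.
move=> ce de; rewrite [in LHS](row_sum_delta v) linear_sum mulmx_sum_row.
apply: eq_bigr => i _; rewrite linearZ; congr (_ *: _).
apply/rowP => j; rewrite !mxE /partial deriveE //.
exact: transition_differentiable.
Qed.

Lemma jac_comp (c d d' : chart E) e : dom c e -> dom d e -> dom d' e ->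
  jac c d' (crd c e) = jac c d (crd c e) *m jac d d' (crd d e).
Proof.
move=> ce de d'e; apply/row_matrixP => i; rewrite row_mul !rowE.
rewrite -(jacE _ ce d'e) -(jacE _ ce de) -(jacE _ de d'e).
exact: diff_transition_comp.
Qed.

Lemma jac_id (c : chart E) e : dom c e -> jac c c (crd c e) = 1%:M.
Proof.
move=> ce; apply/row_matrixP => i; rewrite !rowE mulmx1 -(jacE _ ce ce).
exact: diff_transition_id.
Qed.

Lemma smooth_partial (c d : chart E) i j :
  smooth_on (crd c @` (dom c `&` dom d))
    (partial (transition c d) i j : 'rV[R]_k -> R^o).
Proof.
have := smooth_lin (atlas_open sE c d) (@mx_entry_continuous R 1 k (0, j))
  (smooth_derive (delta_mx 0 i) (atlas_smooth sE c d)).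
exact.
Qed.

End Jacobian.

Arguments smooth_partial {R k E} _ c d i j.

Lemma mulmx_tr_tr (R : comPzRingType) (m n : nat) (A : 'M[R]_m)
    (P : 'M[R]_(m, n)) (B : 'M[R]_n) a i :
  (A^T *m P *m B^T) a i = \sum_j \sum_b B i j * A b a * P b j.
Proof.
rewrite !mxE; apply: eq_bigr => j _; rewrite !mxE mulr_suml.
by apply: eq_bigr => b _; rewrite !mxE mulrC mulrA.
Qed.

Section JetAtlas.
Context {R : realType} {m n : nat} {T : atlas 'rV[R]_m} {M : atlas 'rV[R]_n}.
Context (sT : smooth_atlas T) (sM : smooth_atlas M).
Local Notation E := (dual_jet T M).
Local Notation V := (@jspace R m n).

Definition jcoords : coords V :=
  pair_coords (pair_coords (mx_coords 1 m) (mx_coords 1 n))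
    (mx_coords m n).

(** The matrix of the [p^a_i] in the chart [d], as a function of the coordinates
    in the chart [q]. *)
Definition change_mx (q d : chart E) (z : V) : 'M[R]_(m, n) :=
  (jac q.1 d.1 z.1.1)^T *m z.2 *m (jac d.2 q.2 (transition q.2 d.2 z.1.2))^T.

Lemma change_mxE (q d : chart E) (z : V) a i :
  change_mx q d z a i = \sum_j \sum_b
    partial (transition d.2 q.2) i j (transition q.2 d.2 z.1.2) *
    partial (transition q.1 d.1) b a z.1.1 * z.2 b j.
Proof.
rewrite mulmx_tr_tr; apply: eq_bigr => j _; apply: eq_bigr => b _.
by rewrite /jac !mxE.
Qed.

Lemma jp_changeE (e : E) (q d : chart E) : dom q e -> dom d e ->
  jp e d.1 d.2 = change_mx q d (crd q e).
Proof.
case: q d => [al be] [al' be'] [/= qt qx] [/= dt dx].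
apply/matrixP => a i; rewrite change_mxE /= (transitionE sM) //.
exact: jp_change.
Qed.

Lemma jet_eq (e e' : E) : jt e = jt e' -> jx e = jx e' -> jp e = jp e' ->
  e = e'.
Proof.
case: e e' => [t x p pc po] [t' x' p' pc' po'] /= tt xx pp.
subst t' x' p'; congr DualJetPt; exact: Prop_irrelevance.
Qed.

(** The dual jet over the base point [(t, x)] with components [P] in the chart
    [q]. Its components in the other charts are forced by the transformation
    rule, and the chain rule for Jacobian matrices makes them compatible. *)
Section MakeJet.
Context (q : chart E) (t : T) (x : M) (qt : dom q.1 t) (qx : dom q.2 x).
Context (P : 'M[R]_(m, n)).

Definition make_jp (al : chart T) (be : chart M) : 'M[R]_(m, n) :=
  if pselect (dom al t /\ dom be x) then
    (jac q.1 al (crd q.1 t))^T *m P *m (jac be q.2 (crd be x))^T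
  else 0.

Lemma make_jp_change (al al' : chart T) (be be' : chart M) :
  dom al t -> dom al' t -> dom be x -> dom be' x ->
  forall a i,
    make_jp al' be' a i = \sum_j \sum_b
      partial (transition be' be) i j (crd be' x) *
      partial (transition al al') b a (crd al t) * make_jp al be b j.
Proof.
move=> alt al't bex be'x a i.
have mE al0 be0 : dom al0 t -> dom be0 x -> make_jp al0 be0 =
    (jac q.1 al0 (crd q.1 t))^T *m P *m (jac be0 q.2 (crd be0 x))^T.
  by move=> ? ?; rewrite /make_jp; case: pselect => // -[].
have jE : jac q.1 al' (crd q.1 t) =
    jac q.1 al (crd q.1 t) *m jac al al' (crd al t) by exact: jac_comp.
have jE' : jac be' q.2 (crd be' x) =
    jac be' be (crd be' x) *m jac be q.2 (crd be x) by exact: jac_comp.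
have -> : make_jp al' be' = (jac al al' (crd al t))^T *m make_jp al be *m
                            (jac be' be (crd be' x))^T.
  rewrite (mE _ _ al't be'x) (mE _ _ alt bex) jE jE' !trmx_mul.
  by rewrite !mulmxA.
rewrite mulmx_tr_tr; apply: eq_bigr => j _; apply: eq_bigr => b _.
by rewrite /jac !mxE.
Qed.

Lemma make_jp_out (al : chart T) (be : chart M) :
  ~ (dom al t /\ dom be x) -> make_jp al be = 0.
Proof. by rewrite /make_jp; case: pselect. Qed.

Definition make_jet : E := DualJetPt make_jp_change make_jp_out.

Lemma crd_make_jet : crd q make_jet = (crd q.1 t, crd q.2 x, P).
Proof.
rewrite /= /make_jp; case: pselect => // -[]; last by [].
by rewrite (jac_id sT qt) (jac_id sM qx) !trmx1 mul1mx mulmx1.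
Qed.

End MakeJet.

(** A chart imposes no condition on the fibre coordinates, since [make_jet]
    accepts every matrix. *)
Lemma jet_imageE (q d : chart E) : crd q @` (dom q `&` dom d) =
  (fun z : V => z.1.1) @^-1` (crd q.1 @` (dom q.1 `&` dom d.1)) `&`
  (fun z : V => z.1.2) @^-1` (crd q.2 @` (dom q.2 `&` dom d.2)).
Proof.
apply/seteqP; split=> [_ [e [[qt qx] [dt dx]] <-]|].
  by split; [exists (jt e)|exists (jx e)].
move=> [[z1 z2] P] [[t [qt dt] /= tz] [x [qx dx] /= xz]].
exists (make_jet qt qx P); first by [].
transitivity (crd q.1 t, crd q.2 x, P); first exact: crd_make_jet.
by rewrite tz xz.
Qed.

Lemma jet_open (q d : chart E) : open (crd q @` (dom q `&` dom d)).
Proof.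
rewrite jet_imageE; apply: openI; apply: open_comp; try exact: atlas_open.
- move=> z _; apply: (@continuous_comp _ _ _ (fun z : V => z.1) fst);
    exact: cvg_fst.
- move=> z _; apply: (@continuous_comp _ _ _ (fun z : V => z.1) snd).
    exact: cvg_fst.
  exact: cvg_snd.
Qed.

(** The base points agree by injectivity of the base charts; the components in
    all other charts around them are then functions of those in [q], and those
    in the charts elsewhere are zero. *)
Lemma jet_inj (q : chart E) : {in dom q &, injective (crd q)}.
Proof.
move=> e e' /set_mem qe /set_mem qe' crdE.
have [qt qx] := qe; have [qt' qx'] := qe'.
have tE : jt e = jt e'.
  by apply: (atlas_inj sT (mem_set qt) (mem_set qt')); case: crdE.
have xE : jx e = jx e'.
  by apply: (atlas_inj sM (mem_set qx) (mem_set qx')); case: crdE.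
apply: jet_eq => //; apply/funext => al; apply/funext => be.
have [[alt bex]|aN] := pselect (dom al (jt e) /\ dom be (jx e)).
  rewrite (jp_changeE (d := (al, be)) qe) // (jp_changeE (d := (al, be)) qe').
    by rewrite crdE.
  by rewrite /= -tE -xE.
by rewrite !jp_out // -tE -xE.
Qed.

Lemma jet_transitionE (q d : chart E) e : dom q e -> dom d e ->
  crd d e = (transition q.1 d.1 (crd q e).1.1, transition q.2 d.2 (crd q e).1.2,
             change_mx q d (crd q e)).
Proof.
move=> qe de; rewrite -jp_changeE //= !transitionE //.
- by case: qe.
- by case: qe.
Qed.

Lemma smooth_jcoord (A : set V) i : open A -> smooth_on A (cfun jcoords i).
Proof.
move=> Ao.
exact: (smooth_lin Ao (@cfun_continuous _ _ jcoords i) (smooth_id Ao)).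
Qed.

Lemma smooth_fst11 (A : set V) : open A -> smooth_on A (fun z : V => z.1.1).
Proof.
move=> Ao; apply: (smooth_coords Ao (cW := mx_coords 1 m)) => k.
exact: (smooth_jcoord (inl (inl k)) Ao).
Qed.

Lemma smooth_fst12 (A : set V) : open A -> smooth_on A (fun z : V => z.1.2).
Proof.
move=> Ao; apply: (smooth_coords Ao (cW := mx_coords 1 n)) => k.
exact: (smooth_jcoord (inl (inr k)) Ao).
Qed.

(** The entries of [change_mx] are sums of products of first derivatives of the
    base transition maps, evaluated at smooth functions of the point, and of
    entries of [p]. *)
Lemma jet_smooth (q d : chart E) :
  smooth_on (crd q @` (dom q `&` dom d)) (transition q d).
Proof.
have Ao := @jet_open q d; set A := _ @` _ in Ao *.
have A1 z : A z -> (crd q.1 @` (dom q.1 `&` dom d.1)) z.1.1.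
  by rewrite /A jet_imageE => -[].
have A2 z : A z -> (crd q.2 @` (dom q.2 `&` dom d.2)) z.1.2.
  by rewrite /A jet_imageE => -[].
have s1 : smooth_on A (fun z : V => transition q.1 d.1 z.1.1).
  exact: (smooth_comp Ao (mx_coords 1 m) (mx_coords 1 m) A1
    (atlas_smooth sT _ _) (smooth_fst11 Ao)).
have s2 : smooth_on A (fun z : V => transition q.2 d.2 z.1.2).
  exact: (smooth_comp Ao (mx_coords 1 n) (mx_coords 1 n) A2
    (atlas_smooth sM _ _) (smooth_fst12 Ao)).
have s3 a i : smooth_on A (fun z => change_mx q d z a i : R^o).
  apply: (smooth_eq Ao) => [z _|]; first by rewrite change_mxE.
  apply: (smooth_sum Ao) => j; apply: (smooth_sum Ao) => b.
  apply: (smoothM Ao); last exact: (smooth_jcoord (inr (b, j)) Ao).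
  apply: (smoothM Ao).
    have A2' z : A z ->
        (crd d.2 @` (dom d.2 `&` dom q.2)) (transition q.2 d.2 z.1.2).
      by move=> /A2[x [qx dx] <-]; rewrite transitionE //; exists x.
    exact: (smooth_comp Ao (mx_coords 1 n) scalar_coords A2'
      (smooth_partial sM d.2 q.2 i j) s2).
  exact: (smooth_comp Ao (mx_coords 1 m) scalar_coords A1
    (smooth_partial sT q.1 d.1 b a) (smooth_fst11 Ao)).
apply: (smooth_eq Ao (f := fun z =>
  (transition q.1 d.1 z.1.1, transition q.2 d.2 z.1.2, change_mx q d z) : V)).
  move=> _ [e [qe de] <-]; rewrite -(jet_transitionE qe de).
  rewrite /transition /in_chart; case: pselect => [ex|[]]; last by exists e.
  by case: cid => e' /= [qe' /(jet_inj (mem_set qe') (mem_set qe)) ->].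
apply: (smooth_coords Ao (cW := jcoords)) => -[[k|k]|[a i]] /=.
- exact: (smooth_lin Ao (@mx_entry_continuous R 1 m k) s1).
- exact: (smooth_lin Ao (@mx_entry_continuous R 1 n k) s2).
- exact: s3.
Qed.

Lemma jet_atlas : smooth_atlas E.
Proof. by split; [exact: jet_inj|exact: jet_open|exact: jet_smooth]. Qed.

End JetAtlas.

(** * The Liouville-Hamilton field *)

Section JetFields.
Context {R : realType} {m n : nat} {T : atlas 'rV[R]_m} {M : atlas 'rV[R]_n}.
Context (sT : smooth_atlas T) (sM : smooth_atlas M).
Local Notation E := (dual_jet T M).
Local Notation V := (@jspace R m n).

Let sE : smooth_atlas E := jet_atlas sT sM.
Let cV : coords V := @jcoords R m n.

(** Along a fibre the transition map is linear and a chart covers the whole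
    fibre; the difference quotients defining the directional derivative are
    therefore constant. *)
Lemma diff_transition_vertical (q d : chart E) (e : E) (P : 'M[R]_(m, n)) :
  dom q e -> dom d e ->
  'd (transition q d) (crd q e) (0, 0, P) =
  (0, 0, (jac q.1 d.1 (crd q.1 (jt e)))^T *m P *m
         (jac d.2 q.2 (crd d.2 (jx e)))^T).
Proof.
move=> qe de; have [qt qx] := qe.
rewrite -(deriveE _ (transition_differentiable sE qe de)) /derive.
set w := RHS.
have lineE h : transition q d (h *: ((0, 0, P) : V) + crd q e) =
    h *: w + transition q d (crd q e).
  (* the jet over the same base point whose components in q are moved by h P *)
  pose e' := make_jet sT sM qt qx (h *: P + jp e q.1 q.2).
  have e'E : crd q e' = h *: ((0, 0, P) : V) + crd q e.
    rewrite (crd_make_jet sT sM).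
    by congr (_, _, _); rewrite /= scaler0 add0r.
  have qe' : dom q e' by [].
  have de' : dom d e' by case: de.
  have [dt' dx'] := de.
  rewrite -e'E (transitionE sE d qe') (transitionE sE d qe).
  rewrite (jet_transitionE sT sM qe' de') (jet_transitionE sT sM qe de) e'E.
  rewrite /change_mx.
  have fstE : (h *: ((0, 0, P) : V) + crd q e).1 = (crd q e).1.
    by congr pair; rewrite /= scaler0 add0r.
  rewrite fstE; congr (_, _, _); rewrite /= ?scaler0 ?add0r //.
  rewrite (transitionE sM _ qx) mulmxDr mulmxDl -scalemxAr -scalemxAl.
  by [].
apply/lim_near_cst => //; near=> h.
have h0 : h != 0 by near: h; exact: nbhs_dnbhs_neq.
rewrite /= lineE addrK scalerA mulVf ?scale1r //.
Unshelve. all: by end_near. Qed.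

Lemma vertical_sum (F : 'I_m -> 'I_n -> R) :
  \sum_a \sum_i F a i *: dp a i = ((0, 0, \matrix_(a, i) F a i) : V).
Proof.
have s1 I (r : seq I) (G : I -> V) :
    (\sum_(k <- r) G k).1 = \sum_(k <- r) (G k).1.
  by rewrite (big_morph (fun x : V => x.1) (id1 := 0) (op1 := +%R)).
have s2 I (r : seq I) (G : I -> V) :
    (\sum_(k <- r) G k).2 = \sum_(k <- r) (G k).2.
  by rewrite (big_morph (fun x : V => x.2) (id1 := 0) (op1 := +%R)).
rewrite [LHS]surjective_pairing; congr pair.
  rewrite s1 big1 // => a _; rewrite s1 big1 // => i _ /=.
  by rewrite /= scaler0.
rewrite s2 [RHS]matrix_sum_delta; apply: eq_bigr => a _.
by rewrite s2; apply: eq_bigr => i _; rewrite mxE.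
Qed.

Lemma liouvilleE (q : chart E) e : liouville e q = (0, 0, jp e q.1 q.2).
Proof.
rewrite /liouville vertical_sum; congr pair.
by apply/matrixP => a i; rewrite mxE.
Qed.

Lemma tangent_liouville (e : E) : tangent e (liouville e).
Proof.
move=> q d qe de; rewrite !liouvilleE diff_transition_vertical //.
congr pair; rewrite (jp_changeE sM qe de) /change_mx /= (transitionE sM) //.
by case: qe.
Qed.

Lemma smooth_fun_pcoord (q : chart E) a i :
  smooth_fun (dom q) (fun e => pcoord q e a i).
Proof.
move=> c; apply: (smooth_change sE cV scalar_coords).
have Ao := open_dom_image sE q.
apply: (smooth_eq Ao _ (smooth_jcoord (inr (a, i)) Ao)).
by move=> _ [e qe <-]; rewrite (in_chartE sE).
Qed.

Arguments smooth_fun_pcoord : clear implicits.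

Lemma diff_pcoord (q : chart E) a i (e : E) (v : V) : dom q e ->
  'd (in_chart q ((fun e => pcoord q e a i) : E -> R^o)) (crd q e) v = v.2 a i.
Proof.
move=> qe; have pc := @cfun_continuous _ _ cV (inr (a, i)).
transitivity ('d (cfun cV (inr (a, i))) (crd q e) v); last by rewrite diff_lin.
refine (@diff_near_chart _ _ _ _ (dom q) q e _ _ v (mopen_dom sE q) qe qe
  _ _ _).
- by move=> e' _ qe'; rewrite (in_chartE sE).
- have := smooth_fun_pcoord q a i q [::] (crd q e); apply.
  by exists e.
- exact: linear_differentiable.
Qed.

Lemma vfield_const (q : chart E) (w : V) :
  vfield (dom q) (chart_field q (fun=> w)).
Proof.
apply: (vfield_chart_field sE cV).
have Ao := open_dom_image sE q.
apply: (smooth_eq Ao _ (smooth_cst w)).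
by move=> _ [e qe <-]; rewrite (in_chartE sE).
Qed.

Lemma liouville_chart (q : chart E) : feq (dom q)
  (fun e c => \sum_(k : 'I_m * 'I_n) pcoord q e k.1 k.2 *: fdp q k.1 k.2 e c)
  liouville.
Proof.
move=> e qe c ce; rewrite (tangent_liouville qe ce) /liouville.
rewrite pair_bigA linear_sum; apply: eq_bigr => k _.
by rewrite linearZ.
Qed.

Lemma vfield_liouville (q : chart E) : vfield (dom q) liouville.
Proof.
apply: (vfield_eq sE (mopen_dom sE q) (@liouville_chart q)).
apply: (vfield_sum sE _ (mopen_dom sE q)) => k.
apply: (vfieldZ sE cV (mopen_dom sE q)); first exact: smooth_fun_pcoord.
exact: vfield_const.
Qed.

(** The Leibniz rule applied to [C = sum p^c_k d/dp^c_k], for an arbitrary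
    direction [X]; [G] stands for whichever family of coefficients gives the
    derivatives of the [d/dp^b_j] along [X]. *)
Lemma cov_liouville (N1 : @Ncoef1 R m n T M) (N2 : @Ncoef2 R m n T M)
    (D : field E -> field E -> field E) (Dlin : linear_connection D)
    (q : chart E) (X : field E)
    (G : E -> 'I_m -> 'I_n -> 'I_m -> 'I_n -> R) e a i :
  vfield (dom q) X ->
  (forall b j, feq (dom q) (D X (fdp q b j))
     (fun e d => - \sum_a \sum_i G e a i b j *: fdp q a i e d)) ->
  dom q e ->
  vcomp N1 N2 q e (D X liouville e q) a i =
  (X e q).2 a i - \sum_c \sum_k G e a i c k * pcoord q e c k.
Proof.
move=> vX DG qe; have Uo := mopen_dom sE q.
pose Y k e c := pcoord q e k.1 k.2 *: (fdp q k.1 k.2 : field E) e c.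
have vY k : vfield (dom q) (Y k).
  by apply: (vfieldZ sE cV Uo (smooth_fun_pcoord q _ _)); exact: vfield_const.
have -> : D X liouville e q = \sum_k D X (Y k) e q.
  rewrite -(connection_sum sE Dlin Uo _ vX vY qe qe).
  apply: (lc_local Dlin Uo vX vX (vfield_liouville q)
    (vfield_sum sE _ Uo vY)) => // e' qe' c ce'.
  by rewrite (liouville_chart qe' ce').
have YE k : D X (Y k) e q = (0, 0, (X e q).2 k.1 k.2 *: delta_mx k.1 k.2 -
    pcoord q e k.1 k.2 *: \matrix_(a, i) G e a i k.1 k.2).
  rewrite (lc_leibniz Dlin Uo (smooth_fun_pcoord q _ _) vX
    (vfield_const q (dp k.1 k.2)) qe qe).
  rewrite (diff_pcoord _ _ _ qe) (DG k.1 k.2 e qe q qe).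
  rewrite (chart_field_self sE _ qe).
  have -> : \sum_a \sum_i G e a i k.1 k.2 *: fdp q a i e q =
            (0, 0, \matrix_(a, i) G e a i k.1 k.2).
    rewrite -vertical_sum; apply: eq_bigr => a' _; apply: eq_bigr => i' _.
    by rewrite /fdp (chart_field_self sE _ qe).
  by congr (_, _, _); rewrite /= ?oppr0 ?scaler0 ?addr0 // scalerN.
under eq_bigr => k _ do rewrite YE.
rewrite /vcomp.
rewrite (big_morph (fun x : V => x.1) (id1 := 0) (op1 := +%R)) //.
rewrite (big_morph (fun x : V => x.2) (id1 := 0) (op1 := +%R)) //=.
rewrite (big1 _ _ (fun k : 'I_m * 'I_n => (0, 0))) //=.
rewrite [X in _ + X + _]big1 => [|k _]; last by rewrite mxE mul0r.
rewrite [X in _ + X]big1 => [|k _]; last by rewrite mxE mul0r.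
rewrite !addr0 summxE (eq_bigr (fun k => (X e q).2 k.1 k.2 * ((a, i) == k)%:R -
  G e a i k.1 k.2 * pcoord q e k.1 k.2)); last first.
  by move=> k _; rewrite !mxE mulrC [_ * G _ _ _ _ _]mulrC.
rewrite [in RHS]pair_bigA big_split sumrN /=; congr (_ - _).
rewrite (bigD1 (a, i)) //= eqxx mulr1 big1 ?addr0 // => k.
by rewrite eq_sym => /negPf ->; rewrite mulr0.
Qed.

End JetFields.

(** * Smoothness of the adapted horizontal fields *)

Section HorizontalFrame.
Context {R : realType} {m n : nat} {T : atlas 'rV[R]_m} {M : atlas 'rV[R]_n}.
Context (sT : smooth_atlas T) (sM : smooth_atlas M).
Local Notation E := (dual_jet T M).
Local Notation V := (@jspace R m n).

Let sE : smooth_atlas E := jet_atlas sT sM.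
Let cV : coords V := @jcoords R m n.

Context (N : tdistribution E) (N1 : @Ncoef1 R m n T M) (N2 : @Ncoef2 R m n T M).
Context (Nsmooth : smooth_distribution (m + n) N)
        (Ncoef : nonlinear_coefficients N N1 N2).

(** The [delta/delta t^a] and [delta/delta x^i] as one family, so that their
    relation to a local frame of [N] is a square matrix. *)
Definition hframe (q : chart E) (k : 'I_(m + n)) (e : E) : V :=
  match fintype.split k with
  | inl a => delta_t N1 q a e
  | inr i => delta_x N2 q i e
  end.

Definition hcoord (k : 'I_(m + n)) (v : V) : R :=
  match fintype.split k with inl a => v.1.1 0 a | inr i => v.1.2 0 i end.

(** The fields of [hframe] project onto the coordinate basis of the base, so
    the coefficients of a horizontal vector are its [t] and [x] components;
    in particular they depend smoothly on it. *)
Lemma hframeE (q : chart E) e v : dom q e -> tangent e v -> N e v ->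
  v q = \sum_k hcoord k (v q) *: hframe q k e.
Proof.
move=> qe tv Nv; have [u [w vE]] := (Ncoef qe tv).1 Nv.
have v1E : (v q).1 = (\row_a u a, \row_i w i).
  rewrite vE /= !(big_morph (fun x : V => x.1) (id1 := 0) (op1 := +%R)) //.
  rewrite [LHS]surjective_pairing /=.
  rewrite !(big_morph fst (id1 := 0) (op1 := +%R)) //.
  rewrite !(big_morph snd (id1 := 0) (op1 := +%R)) //; congr pair.
    rewrite [X in _ + X]big1 ?addr0 => [|i _]; last first.
      by rewrite /delta_x vertical_sum /= subr0 scaler0.
    rewrite [RHS]row_sum_delta; apply: eq_bigr => a _.
    by rewrite /delta_t vertical_sum /= subr0 mxE.
  rewrite [X in X + _]big1 ?add0r => [|a _]; last first.
    by rewrite /delta_t vertical_sum /= subr0 scaler0.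
  rewrite [RHS]row_sum_delta; apply: eq_bigr => i _.
  by rewrite /delta_x vertical_sum /= subr0 mxE.
rewrite {1}vE big_split_ord /=; congr (_ + _); apply: eq_bigr => k _.
- by rewrite /hcoord /hframe (unsplitK (inl k)) v1E mxE.
- by rewrite /hcoord /hframe (unsplitK (inr k)) v1E mxE.
Qed.

Lemma smooth_hcoord (A : set V) k : open A ->
  smooth_on A (hcoord k : V -> R^o).
Proof.
move=> Ao; rewrite /hcoord; case: (fintype.split k) => a.
- exact: (smooth_jcoord (inl (inl (0, a))) Ao).
- exact: (smooth_jcoord (inl (inr (0, a))) Ao).
Qed.

(** Near any point [N] has a smooth frame [Z], and [Z = B * hframe] where [B] is
    made of components of [Z], hence smooth. Linear independence of [Z] makes
    [B] invertible, and [hframe = B^-1 * Z] is smooth. *)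
Lemma smooth_hframe (q : chart E) k :
  smooth_on (crd q @` dom q) (in_chart q (hframe q k)).
Proof.
move=> vs _ [e0 qe0 <-].
have [U [Z [Uo Ue0 vZ NZ]]] := Nsmooth e0.
have Ao := Uo q; set A := crd q @` (U `&` dom q) in Ao *.
suff: smooth_on A (in_chart q (hframe q k)) by apply; exists e0.
pose zeta i := in_chart q (fun e => Z i e q).
pose B z : 'M[R]_(m + n) := \matrix_(i, l) hcoord l (zeta i z).
have zetaE i e : dom q e -> zeta i (crd q e) = Z i e q.
  by move=> qe; rewrite /zeta (in_chartE sE).
have ZE i e : U e -> dom q e ->
    Z i e q = \sum_l B (crd q e) i l *: hframe q l e.
  move=> Ue qe; have [tZ _] := vZ i.
  rewrite {1}(hframeE qe (tZ e Ue)).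
    by apply: eq_bigr => l _; rewrite mxE zetaE.
  apply/((NZ e Ue).2 _ (tZ e Ue)); exists (fun j => (i == j)%:R) => c _.
  rewrite (bigD1 i) //= eqxx scale1r big1 ?addr0 // => j.
  by rewrite eq_sym => /negPf ->; rewrite scale0r.
have Bunit z : A z -> B z \in unitmx.
  move=> [e [Ue qe] <-]; rewrite -row_free_unit -kermx_eq0.
  apply/rowV0P => u /sub_kermxP uB0.
  have Zq0 : \sum_i u 0 i *: Z i e q = 0.
    under eq_bigr => i _ do rewrite (ZE i e Ue qe) scaler_sumr.
    rewrite exchange_big big1 //= => l _.
    under eq_bigr => i _ do rewrite scalerA.
    rewrite -scaler_suml.
    have := congr1 (fun w : 'rV_(m + n) => w 0 l) uB0.
    by rewrite !mxE => ->; rewrite scale0r.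
  apply/rowP => i; rewrite mxE; apply: (NZ e Ue).1 => c ce.
  (* a tangent vector is determined by its components in one chart *)
  have -> : \sum_i u 0 i *: Z i e c =
            'd (transition q c) (crd q e) (\sum_i u 0 i *: Z i e q).
    rewrite linear_sum; apply: eq_bigr => j _; rewrite linearZ.
    by have [tZ _] := vZ j; rewrite -(tZ e Ue q c qe ce).
  by rewrite Zq0 linear0.
have szeta i : smooth_on A (zeta i) by have [_] := vZ i; exact.
have sB i l : smooth_on A (fun z => B z i l : R^o).
  apply: (smooth_eq Ao (f := hcoord l \o zeta i)) => [z _|].
    by rewrite mxE.
  exact: (smooth_comp Ao cV scalar_coords (B := setT) _
    (smooth_hcoord l openT)).
apply: (smooth_eq Ao (f := fun z => \sum_i invmx (B z) k i *: zeta i z)).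
  move=> _ [e [Ue qe] <-]; rewrite (in_chartE sE) //.
  under eq_bigr => i _ do rewrite zetaE // (ZE i e Ue qe) scaler_sumr.
  rewrite exchange_big /= (eq_bigr (fun l => (k == l)%:R *: hframe q l e)).
    rewrite (bigD1 k) //= eqxx scale1r big1 ?addr0 // => l.
    by rewrite eq_sym => /negPf ->; rewrite scale0r.
  move=> l _; under eq_bigr => i _ do rewrite scalerA.
  rewrite -scaler_suml; congr (_ *: _).
  have /matrixP/(_ k l) : invmx (B (crd q e)) *m B (crd q e) = 1%:M.
    by apply/mulVmx/Bunit; exists e.
  by rewrite !mxE.
apply: (smooth_sum Ao) => i; apply: (smoothZ Ao cV); last exact: szeta.
exact: (smooth_invmx Ao Bunit sB).
Qed.

Lemma vfield_delta_t (q : chart E) a : vfield (dom q) (fdelta_t N1 q a).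
Proof.
apply: (vfield_chart_field sE cV).
have -> : delta_t N1 q a = hframe q (lshift n a).
  by apply/funext => e; rewrite /hframe (unsplitK (inl a)).
exact: smooth_hframe.
Qed.

Lemma vfield_delta_x (q : chart E) i : vfield (dom q) (fdelta_x N2 q i).
Proof.
apply: (vfield_chart_field sE cV).
have -> : delta_x N2 q i = hframe q (rshift m i).
  by apply/funext => e; rewrite /hframe (unsplitK (inr i)).
exact: smooth_hframe.
Qed.

End HorizontalFrame.

Lemma delta_t_fiber (R : realType) (m n : nat) (T : atlas 'rV[R]_m)
    (M : atlas 'rV[R]_n) (N1 : @Ncoef1 R m n T M) q b e a i :
  (delta_t N1 q b e).2 a i = - N1 q e a i b.
Proof. by rewrite /delta_t vertical_sum /= sub0r !mxE. Qed.

Lemma delta_x_fiber (R : realType) (m n : nat) (T : atlas 'rV[R]_m)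
    (M : atlas 'rV[R]_n) (N2 : @Ncoef2 R m n T M) q j e a i :
  (delta_x N2 q j e).2 a i = - N2 q e a i j.
Proof. by rewrite /delta_x vertical_sum /= sub0r !mxE. Qed.

Theorem proposition6p14 (R : realType) (m n : nat)
    (T : atlas 'rV[R]_m) (M : atlas 'rV[R]_n)
    (smT : smooth_manifold T) (smM : smooth_manifold M)
    (N : tdistribution (dual_jet T M))
    (N1 : @Ncoef1 R m n T M) (N2 : @Ncoef2 R m n T M)
    (Nconn : nonlinear_connection N) (Ncoef : nonlinear_coefficients N N1 N2)
    (D : field (dual_jet T M) -> field (dual_jet T M) -> field (dual_jet T M))
    (Dconn : N_linear_connection N1 N2 D)
    (A : @Acoef R m n T M) (H : @Hcoef R m n T M) (C : @Ccoef R m n T M)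
    (Dcoef : vertical_coefficients N1 N2 D A H C)
    (q : chart (dual_jet T M)) (e : dual_jet T M) (qe : dom q e) :
  [/\ (forall (a : 'I_m) (i : 'I_n) (b : 'I_m),
         cov_t N1 N2 D liouville q b e a i =
           - N1 q e a i b
           - \sum_(c < m) \sum_(k < n) A q e a i c k b * pcoord q e c k),
      (forall (a : 'I_m) (i : 'I_n) (j : 'I_n),
         cov_x N1 N2 D liouville q j e a i =
           - N2 q e a i j
           - \sum_(c < m) \sum_(k < n) H q e a i c k j * pcoord q e c k) &
      (forall (a : 'I_m) (i : 'I_n) (b : 'I_m) (j : 'I_n),
         cov_p N1 N2 D liouville q b j e a i =
           (a == b)%:R * (j == i)%:R
           - \sum_(c < m) \sum_(k < n) C q e a i c k b j * pcoord q e c k)].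
Proof.
have sT := smooth_manifold_atlas smT; have sM := smooth_manifold_atlas smM.
have sE := jet_atlas sT sM.
have [Nsmooth _] := Nconn; have [Dlin _ _ _] := Dconn.
have [DA DH DC] := Dcoef.
split=> [a i b|a i j|a i b j].
- rewrite /cov_t (cov_liouville sT sM N1 N2 Dlin
    (G := fun e a i c k => A q e a i c k b)) //.
  + by rewrite /fdelta_t (chart_field_self sE _ qe) delta_t_fiber.
  + exact: (vfield_delta_t sT sM Nsmooth Ncoef).
- rewrite /cov_x (cov_liouville sT sM N1 N2 Dlin
    (G := fun e a i c k => H q e a i c k j)) //.
  + by rewrite /fdelta_x (chart_field_self sE _ qe) delta_x_fiber.
  + exact: (vfield_delta_x sT sM Nsmooth Ncoef).
- rewrite /cov_p (cov_liouville sT sM N1 N2 Dlin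
    (G := fun e a i c k => C q e a i c k b j)) //.
  + rewrite /fdp (chart_field_self sE _ qe) /= mxE (eq_sym j).
    by case: (a == b); case: (i == j); rewrite /= ?mulr0 ?mulr1.
  + exact: vfield_const.
Qed.
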